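(* Let $\mathbf A_k,\mathbf B_k$ ($k=1,\dots,K$), $\mathbf C\in\mathbb R^{n\times n}$ be the constant matrices defined in the context and let $P>0$. Consider the optimization problem $$(\mathrm{P2})\qquad \min_{\boldsymbol\mu,\{\lambda_i\}_{i=1}^K}\ \sum_{k=1}^K\lambda_k\,\frac{\frac1P+\boldsymbol\mu^{\mathrm T}\mathbf B_k\boldsymbol\mu}{\frac1P+\boldsymbol\mu^{\mathrm T}(\mathbf A_k+\mathbf B_k)\boldsymbol\mu}\quad\text{s.t.}\quad \prod_{i=1}^K\lambda_i=1,\ \lambda_i\ge0,\ \ \|\mathbf C\boldsymbol\mu\|_F^2=1,\ \boldsymbol\mu\in\mathbb R^n .$$ Then the following iterative algorithm converges to a local optimum of (P2): start from an initial $\boldsymbol\mu^{[0]}$ and, for $t=0,1,2,\dots$ until convergence, set $$\lambda_i^{[t+1]}=\left[\prod_{\ell=1}^K\frac{\frac1P+(\boldsymbol\mu^{[t]})^{\mathrm T}\mathbf B_\ell\boldsymbol\mu^{[t]}}{\frac1P+(\boldsymbol\mu^{[t]})^{\mathrm T}(\mathbf A_\ell+\mathbf B_\ell)\boldsymbol\mu^{[t]}}\right]^{1/K}\cdot\frac{\frac1P+(\boldsymbol\mu^{[t]})^{\mathrm T}(\mathbf A_i+\mathbf B_i)\boldsymbol\mu^{[t]}}{\frac1P+(\boldsymbol\mu^{[t]})^{\mathrm T}\mathbf B_i\boldsymbol\mu^{[t]}},\qquad i=1,\dots,K,$$ $$\boldsymbol\mu^{[t+1]}=\underset{\mathbf x}{\mathrm{argmin}}\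 \sum_{k=1}^K\lambda_k^{[t+1]}\,\frac{\frac1P+\mathbf x^{\mathrm T}\mathbf B_k\mathbf x}{\frac1P+\mathbf x^{\mathrm T}(\mathbf A_k+\mathbf B_k)\mathbf x}\quad\text{s.t.}\quad\|\mathbf C\mathbf x\|^2\le1 .$$
   Context: **Parameters.** $n$ transmitters with $M_{TX}$ antennas each, $M=nM_{TX}$, $K$ receivers, $\beta=M/K\ge 1$; deterministic Hermitian positive semidefinite correlation matrices $\boldsymbol\Theta_k\in\mathbb C^{M\times M}$; parameters $\sigma_k^{(j)}\in[0,1]$ (CSI error level at transmitter $j$ for receiver $k$), $\rho_k^{(j,j')}\in[0,1]$ with $\rho_k^{(j,j)}=1$ (CSI error correlation between transmitters $j$ and $j'$); fixed regularization coefficients $\alpha^{(j)}>0$, $j=1,\dots,n$; total power $P>0$. $\mathbf E_j^{\mathrm H}=[\mathbf 0_{M_{TX}\times(j-1)M_{TX}},\ \mathbf I_{M_{TX}},\ \mathbf 0_{M_{TX}\times(n-j)M_{TX}}]$. **Auxiliary quantities.** $c_{0,k}^{(j)}=1-(\sigma_k^{(j)})^2$, $c_{1,k}^{(j)}=(\sigma_k^{(j)})^2$, $c_{2,k}^{(j)}=\sigma_k^{(j)}\sqrt{1-(\sigma_k^{(j)})^2}$. For each $j$, $(m_k^{(j)})_{k=1}^K$ solves $$m_k^{(j)}=\frac1M\mathrm{tr}\Big(\boldsymbol\Theta_k\Big(\frac1M\sum_{\ell=1}^K\frac{\boldsymbol\Theta_\ell}{1+m_\ell^{(j)}}+\alpha^{(j)}\mathbf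 I_M\Big)^{-1}\Big)$$ (the limit of the iteration of this map started from $m_k^{(j)}=1/\alpha^{(j)}$ for all $k$), $\mathbf Q_o^{(j)}=\big(\frac1M\sum_{k}\frac{\boldsymbol\Theta_k}{1+m_k^{(j)}}+\alpha^{(j)}\mathbf I_M\big)^{-1}$, and $\Phi^o_{j,k}=\frac1M\mathrm{tr}(\boldsymbol\Theta_k\mathbf E_j\mathbf E_j^{\mathrm H}\mathbf Q_o^{(j)})$ (taken to be real). With $\kappa_k=\kappa_k^{(j,j')}=\sqrt{c_{0,k}^{(j)}c_{0,k}^{(j')}}+\sqrt{c_{1,k}^{(j)}c_{1,k}^{(j')}}\,\rho_k^{(j,j')}$, for $\mathbf X\in\mathbb C^{M\times M}$, $$\Gamma^o_{j,j'}(\mathbf X)=\frac1M\sum_{k=1}^K\frac{\big(\kappa_k+\kappa_k^2\,\Gamma^o_{j,j'}(\boldsymbol\Theta_k)\big)\,\frac1M\mathrm{tr}\big(\boldsymbol\Theta_k\mathbf Q_o^{(j')}\mathbf X\mathbf Q_o^{(j)}\big)}{(1+m_k^{(j)})(1+m_k^{(j')})},$$ where $\Gamma^o_{j,j'}(\boldsymbol\Theta_k)$ is the $k$-th entry of the solution $\boldsymbol\gamma$ of $\mathbf G\boldsymbol\gamma=\mathbf b$ with $$[\mathbf G]_{\ell,t}=1_{\ell=t}-\frac{\kappa_t^2\,\mathrm{tr}(\boldsymbol\Theta_t\mathbf Q_o^{(j')}\boldsymbol\Theta_\ell\mathbf Q_o^{(j)})}{M^2(1+m_t^{(j)})(1+m_t^{(j')})},\qquad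 [\mathbf b]_\ell=\frac1M\sum_{k=1}^K\frac{\kappa_k}{(1+m_k^{(j)})(1+m_k^{(j')})}\frac{\mathrm{tr}(\boldsymbol\Theta_k\mathbf Q_o^{(j')}\boldsymbol\Theta_\ell\mathbf Q_o^{(j)})}{M}.$$ **The constant matrices.** For $j,j'\in\{1,\dots,n\}$, $$[\mathbf A_k]_{j,j'}=\sqrt{\frac{c_{0,k}^{(j)}c_{0,k}^{(j')}}{\Gamma^o_{j,j}(\mathbf I_M)\Gamma^o_{j',j'}(\mathbf I_M)}}\;\frac{\Phi^o_{j,k}\Phi^o_{j',k}}{(1+m_k^{(j)})(1+m_k^{(j')})},$$ $$[\mathbf B_k]_{j,j'}=\frac{1}{\sqrt{\Gamma^o_{j,j}(\mathbf I_M)\Gamma^o_{j',j'}(\mathbf I_M)}}\Bigg(\Gamma^o_{j,j'}(\mathbf E_{j'}\mathbf E_{j'}^{\mathrm H}\boldsymbol\Theta_k\mathbf E_j\mathbf E_j^{\mathrm H})-2\Gamma^o_{j,j'}(\boldsymbol\Theta_k\mathbf E_j\mathbf E_j^{\mathrm H})\frac{c_{0,k}^{(j')}\Phi^o_{j',k}}{1+m_k^{(j')}}+\Phi^o_{j',k}\Phi^o_{j,k}\Gamma^o_{j,j'}(\boldsymbol\Theta_k)\frac{c_{0,k}^{(j)}c_{0,k}^{(j')}+\rho_k^{(j,j')}c_{2,k}^{(j)}c_{2,k}^{(j')}}{(1+m_k^{(j)})(1+m_k^{(j')})}\Bigg),$$ $$\mathbf C=\mathrm{diag}\left(\sqrt{\frac{\Gamma^o_{1,1}(\mathbf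 E_1\mathbf E_1^{\mathrm H})}{\Gamma^o_{1,1}(\mathbf I_M)}},\dots,\sqrt{\frac{\Gamma^o_{n,n}(\mathbf E_n\mathbf E_n^{\mathrm H})}{\Gamma^o_{n,n}(\mathbf I_M)}}\right).$$
   Formalization: ''Local optimum'' is taken as optimal in μ and in λ separately and jointly to first order; ''converges'' as to the set of such points of one value; assumes 1/P+xᵀB_k x>0 on the ball and at μ[0], some A_k≠0, C invertible, constants well defined. Literally false (n=K=2 saddle). *)

(* Defs.v *)
From HB Require Import structures.
From mathcomp Require Export all_boot all_order all_algebra.
From mathcomp Require Export sesquilinear spectral complex.
From mathcomp Require Export all_classical all_reals all_analysis.

Set Implicit Arguments.
Unset Strict Implicit.
Unset Printing Implicit Defensive.

Export Order.TTheory GRing.Theory Num.Theory numFieldNormedType.Exports.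
Local Open Scope classical_set_scope.
Local Open Scope ring_scope.
Local Open Scope complex_scope.
Local Open Scope sesquilinear_scope.

Definition psdmx (F : numClosedFieldType) (d : nat) (X : 'M[F]_d) : Prop :=
  X \is hermsymmx /\ forall v : 'cV[F]_d, 0 <= (v^t* *m X *m v) 0 0.

(* Indices are 0-based; M = n * p, where p is the number of antennas per
   transmitter. Arguments are ordered (transmitter, receiver). *)
Section DeterministicEquivalents.
Variables (R : realType) (n p K : nat).
Variable Theta : 'I_K -> 'M[R[i]]_(n * p).
Variables (sigma : 'I_n -> 'I_K -> R) (rho : 'I_n -> 'I_n -> 'I_K -> R).
Variable alpha : 'I_n -> R.

Local Notation Mc := ((n * p)%:R : R[i]).

Definition Emx (j : 'I_n) : 'M[R[i]]_(n * p, p) :=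
  \matrix_(i, a) (i == j * p + a :> nat)%N%:R.

Definition EEmx (j : 'I_n) : 'M[R[i]]_(n * p) := Emx j *m (Emx j)^t*.

Definition c0 j k : R := 1 - sigma j k ^+ 2.
Definition c1 j k : R := sigma j k ^+ 2.
Definition c2 j k : R := sigma j k * Num.sqrt (1 - sigma j k ^+ 2).

Definition Qof (j : 'I_n) (m : 'I_K -> R) : 'M[R[i]]_(n * p) :=
  invmx (Mc^-1 *: (\sum_k (1 + (m k)%:C)^-1 *: Theta k) + ((alpha j)%:C)%:M).

(* For m >= 0 this is a trace of a product of two positive semidefinite
   matrices, hence real: Re only changes the type. *)
Definition m_map (j : 'I_n) (m : 'I_K -> R) : 'I_K -> R :=
  fun k => complex.Re (Mc^-1 * \tr (Theta k *m Qof j m)).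

Definition is_m_solution (m : 'I_n -> 'I_K -> R) : Prop :=
  forall j, m j = m_map j (m j) /\
    forall k, iter t (m_map j) (fun=> (alpha j)^-1) k @[t --> \oo] --> m j k.

Variable m : 'I_n -> 'I_K -> R.

Local Notation Q j := (Qof j (m j)).
Local Notation mc j k := ((m j k)%:C).

Definition Phi (j : 'I_n) (k : 'I_K) : R[i] :=
  Mc^-1 * \tr (Theta k *m EEmx j *m Q j).

Definition kappa (j j' : 'I_n) (k : 'I_K) : R :=
  Num.sqrt (c0 j k * c0 j' k) + Num.sqrt (c1 j k * c1 j' k) * rho j j' k.

Definition Gmx (j j' : 'I_n) : 'M[R[i]]_K :=
  \matrix_(l, t) ((l == t)%:R -
    (kappa j j' t ^+ 2)%:C * \tr (Theta t *m Q j' *m Theta l *m Q j)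
      / (Mc ^+ 2 * (1 + mc j t) * (1 + mc j' t))).

Definition bvec (j j' : 'I_n) : 'cV[R[i]]_K :=
  \col_l (Mc^-1 * \sum_k
    (kappa j j' k)%:C / ((1 + mc j k) * (1 + mc j' k))
      * (\tr (Theta k *m Q j' *m Theta l *m Q j) / Mc)).

Definition gammavec (j j' : 'I_n) : 'cV[R[i]]_K := invmx (Gmx j j') *m bvec j j'.

Definition Gam (j j' : 'I_n) (X : 'M[R[i]]_(n * p)) : R[i] :=
  Mc^-1 * \sum_k
    ((kappa j j' k)%:C + (kappa j j' k ^+ 2)%:C * gammavec j j' k 0)
      * (Mc^-1 * \tr (Theta k *m Q j' *m X *m Q j))
      / ((1 + mc j k) * (1 + mc j' k)).

Definition Amat (k : 'I_K) : 'M[R[i]]_n :=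
  \matrix_(j, j')
    (sqrtC ((c0 j k * c0 j' k)%:C / (Gam j j 1%:M * Gam j' j' 1%:M))
      * (Phi j k * Phi j' k / ((1 + mc j k) * (1 + mc j' k)))).

Definition Bmat (k : 'I_K) : 'M[R[i]]_n :=
  \matrix_(j, j')
    ((sqrtC (Gam j j 1%:M * Gam j' j' 1%:M))^-1
      * (Gam j j' (EEmx j' *m Theta k *m EEmx j)
         - 2 * Gam j j' (Theta k *m EEmx j)
             * ((c0 j' k)%:C * Phi j' k / (1 + mc j' k))
         + Phi j' k * Phi j k * Gam j j' (Theta k)
             * ((c0 j k * c0 j' k + rho j j' k * c2 j k * c2 j' k)%:C
                 / ((1 + mc j k) * (1 + mc j' k))))).

Definition Cmat : 'M[R[i]]_n :=
  diag_mx (\row_j sqrtC (Gam j j (EEmx j) / Gam j j 1%:M)).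

End DeterministicEquivalents.

Section ProblemP2.
Variables (R : realType) (n K : nat).
Variables (A B : 'I_K -> 'M[R]_n) (C : 'M[R]_n) (P : R).
Implicit Types (x mu : 'cV[R]_n) (lam : 'rV[R]_K) (z : 'cV[R]_n * 'rV[R]_K).

Definition qform (X : 'M[R]_n) x : R := (x^T *m X *m x) 0 0.

(* The library norm `|x| on matrices is the maximum norm. *)
Definition sqnormF x : R := \sum_i x i 0 ^+ 2.

Definition num k x : R := P^-1 + qform (B k) x.
Definition den k x : R := P^-1 + qform (A k + B k) x.

Definition objective z : R := \sum_k z.2 0 k * (num k z.1 / den k z.1).

Definition feasible z : Prop :=
  [/\ \prod_i z.2 0 i = 1, forall i, 0 <= z.2 0 i & sqnormF (C *m z.1) = 1].

Definition lambda_step mu : 'rV[R]_K :=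
  \row_i ((\prod_l (num l mu / den l mu)) `^ (K%:R^-1)
          * (den i mu / num i mu)).

Definition is_argmin (T : Type) (D : set T) (f : T -> R) (x : T) : Prop :=
  D x /\ forall y, D y -> f x <= f y.

(* lam 0 is not used: the multipliers start at lam 1. The argmin need not be
   unique (the objective is even in mu), so any minimizer may be selected. *)
Definition algorithm_run (mu : nat -> 'cV[R]_n) (lam : nat -> 'rV[R]_K) :=
  forall t : nat, lam t.+1 = lambda_step (mu t) /\
    is_argmin [set x | sqnormF (C *m x) <= 1]
              (fun x => objective (x, lam t.+1)) (mu t.+1).

(* Local optimality in the sense of alternating minimization: a feasible point
   that is globally optimal in each of the two blocks and locally optimal in
   (mu, lam) jointly up to an error o(|y - z|), i.e. to first order.
   Joint local minimality without the o(|y - z|) cannot be guaranteed: for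
   n = K = 2, p = 1, Theta_k = I, alpha = 1, P = 10, sigma_k^(k) = 0,
   sigma_k^(j) = 1 for j != k and rho^(1,2) = 0, started at mu = (1, 1)^T, the
   algorithm stays, up to sign changes of the coordinates of mu, at
   mu = (1, 1)^T with lam = (1, 1), where min_lam (objective) has a strict
   local maximum along the sphere |C mu| = 1. *)
Definition local_optimum z : Prop :=
  [/\ feasible z,
      forall mu, feasible (mu, z.2) -> objective z <= objective (mu, z.2),
      forall lam, feasible (z.1, lam) -> objective z <= objective (z.1, lam)
    & forall e : R, 0 < e ->
        \forall y \near nbhs z,
          feasible y -> objective z <= objective y + e * `|y - z| ].

(* Since minimizers may be selected arbitrarily (e.g. with alternating signs),
   the iterates converge to the set of local optima of one common value. *)
Definition converges_to_local_optimum (z : nat -> 'cV[R]_n * 'rV[R]_K) :=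
  nonincreasing_seq (objective \o z) /\
  exists v : R,
    [/\ objective (z t) @[t --> \oo] --> v,
        forall e : R, 0 < e -> \forall t \near \oo,
          exists2 w, local_optimum w /\ objective w = v & `|z t - w| < e
      & forall w, cluster (z @ \oo) w -> local_optimum w /\ objective w = v].

End ProblemP2.

(* Main.v *)
Require Import Defs.
From mathcomp Require Import ring lra.

Set Implicit Arguments.
Unset Strict Implicit.
Unset Printing Implicit Defensive.
Local Open Scope classical_set_scope.
Local Open Scope ring_scope.
Local Open Scope complex_scope.

(** Each [A k] is positive semidefinite of rank at most one, so every ratio
    num/den lies in (0, 1] on the compact ellipsoid |C x| <= 1 and does not
    increase under dilation: minimizers over the ellipsoid lie on its boundary,
    and are therefore feasible for (P2). By AM-GM, [lambda_step mu] is the exact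
    minimizer of the objective in the multipliers. The algorithm is thus
    alternating exact minimization of a continuous function on a compact set; the
    values decrease to some [v], and the values after each half step converge to
    the same [v], so that every cluster point is optimal in each block. As the
    objective is linear in the multipliers, block optimality implies joint local
    optimality up to first order. *)

(** * Cluster points of filters and of sequences in a compact set *)

Section ClusterPoints.
Variable T : topologicalType.
Implicit Types (F : set_system T) (x w : T).

Lemma cluster_continuous (U : topologicalType) F (h : T -> U) w :
  cluster F w -> {for w, continuous h} -> cluster (h @ F) (h w).
Proof.
move=> Fw hw X Y FX Yhw.
by have [t [Xt Yt]] := Fw _ _ FX (hw _ Yhw); exists (h t).
Qed.

Lemma cluster_closed (U : topologicalType) F (h : T -> U) (D : set U) w :
  cluster F w -> {for w, continuous h} -> closed D ->
  (\forall t \near F, D (h t)) -> D (h w).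
Proof.
move=> Fw hw clD FD; apply: clD => V Vhw.
by have [t [Dt Vt]] := Fw _ _ FD (hw _ Vhw); exists (h t).
Qed.

Lemma cluster_lim (U : topologicalType) F (h : T -> U) (l : U) w :
  hausdorff_space U -> cluster F w -> {for w, continuous h} ->
  h @ F --> l -> h w = l.
Proof.
move=> hU Fw hw hl; apply/esym/hU.
exact: cvg_cluster hl _ (cluster_continuous Fw hw).
Qed.

End ClusterPoints.

(** By the near-covering form of compactness: around a cluster point the ball of radius [e] works,
    and any other point of [K] has a neighbourhood that the sequence eventually avoids. *)
Lemma compact_near_cluster (R : numFieldType) (V : normedModType R)
    (K : set V) (z : nat -> V) (e : R) : 0 < e -> compact K ->
  (\forall t \near \oo, K (z t)) ->
  \forall t \near \oo, exists2 w, cluster (z @ \oo) w & `|z t - w| < e.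
Proof.
move=> e0 /compact_near_coveringP cK nK.
have : \forall t \near \oo, K `<=` [set x | z t = x ->
    exists2 w, cluster (z @ \oo) w & `|x - w| < e].
  apply: cK => x Kx.
  have [xz|/existsNP[X /existsNP[Y]]] := pselect (cluster (z @ \oo) x).
    exists (ball x e, setT) => /=.
      by split; [exact: nbhsx_ballx | exact: filterT].
    move=> [y t] /= [xy _] _; exists x => //.
    by move: xy; rewrite -ball_normE /= distrC.
  move=> /not_implyP[zX /not_implyP[xY XY0]].
  exists (Y, z @^-1` X) => //= -[y t] /= [Yy Xzt] zty.
  by exfalso; apply: XY0; exists y; split=> //; rewrite -zty.
move=> nP; apply: filterS2 nP nK => t KP Kt.
exact: KP Kt erefl.
Qed.

(** * Entrywise convergence of matrices and compact boxes *)

Section Matrices.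
Variable R : realType.

Lemma cvg_coord (T : Type) (F : set_system T) m n
    (g : T -> 'M[R]_(m, n)) (x : 'M[R]_(m, n)) i j :
  g @ F --> x -> g t i j @[t --> F] --> x i j.
Proof.
move=> gx.
by apply: (@cvg_comp _ _ _ g (fun M => M i j) _ _ _ gx);
   exact: coord_continuous.
Qed.

Lemma cvg_bigsum (T : Type) (F : set_system T) {FF : Filter F} (I : finType)
    (f : I -> T -> R) (l : I -> R) :
  (forall i, f i @ F --> l i) -> \sum_i f i t @[t --> F] --> \sum_i l i.
Proof. by move=> fl; apply: cvg_big => //; exact: add_continuous. Qed.

Lemma cvg_bigprod (T : Type) (F : set_system T) {FF : Filter F} (I : finType)
    (f : I -> T -> R) (l : I -> R) :
  (forall i, f i @ F --> l i) -> \prod_i f i t @[t --> F] --> \prod_i l i.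
Proof. by move=> fl; apply: cvg_big => //; exact: mul_continuous. Qed.

Lemma cvg_mulmx (T : Type) (F : set_system T) {FF : Filter F} m n p
    (X : T -> 'M[R]_(m, n)) (Y : T -> 'M[R]_(n, p))
    (X0 : 'M[R]_(m, n)) (Y0 : 'M[R]_(n, p)) i j :
  X @ F --> X0 -> Y @ F --> Y0 ->
  (X t *m Y t) i j @[t --> F] --> (X0 *m Y0) i j.
Proof.
move=> hX hY; rewrite mxE; under eq_cvg do rewrite mxE.
by apply: cvg_bigsum => k; apply: cvgM; exact: cvg_coord.
Qed.

Lemma cvg_mx (T : Type) (F : set_system T) {FF : Filter F} m n
    (g : T -> 'M[R]_(m, n)) (x : 'M[R]_(m, n)) :
  (forall i j, g t i j @[t --> F] --> x i j) -> g @ F --> x.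
Proof.
move=> gx; apply/cvgrPdist_lt => e e0.
have : \forall t \near F, forall i j, `|x i j - g t i j| < e.
  apply: filter_forall => i; apply: filter_forall => j.
  by move/cvgrPdist_lt : (gx i j); exact.
apply: filterS => t ht; rewrite [ltLHS]/Num.Def.normr /= mx_normrE.
by apply/bigmax_ltP; split=> // -[i j] _ /=; rewrite !mxE.
Qed.

Lemma ler_mx_norm m n (x : 'M[R]_(m, n)) i j : `|x i j| <= `|x|.
Proof.
rewrite [leRHS]/Num.Def.normr /= mx_normrE.
by apply/bigmax_geP; right; exists (i, j).
Qed.

Lemma cvg_trmx (T : Type) (F : set_system T) {FF : Filter F} m n
    (g : T -> 'M[R]_(m, n)) (x : 'M[R]_(m, n)) :
  g @ F --> x -> (g t)^T @[t --> F] --> x^T.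
Proof.
by move=> gx; apply: cvg_mx => i j; rewrite mxE; under eq_cvg do rewrite mxE;
   exact: cvg_coord.
Qed.

(** Compactness is transported by transposition from a product of segments of row vectors. *)
Lemma compact_cV_box n (c : R) :
  compact [set x : 'cV[R]_n | forall i, `|x i 0| <= c].
Proof.
have -> : [set x : 'cV[R]_n | forall i, `|x i 0| <= c] =
    trmx @` [set x : 'rV[R]_n | forall i, x 0 i \in `[- c, c]].
  apply/seteqP; split=> [x xc|_ [x xc <-] i] /=.
    exists x^T; last by rewrite trmxK.
    by move=> i; rewrite mxE in_itv /= -ler_norml.
  by rewrite mxE ler_norml; have := xc i; rewrite in_itv.
apply: continuous_compact.
  apply: continuous_subspaceT => x.
  apply: (@cvg_trmx _ (nbhs x) _ _ _ id x); exact: cvg_id.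
by move: (@rV_compact R n (fun=> `[- c, c]%classic)); apply => _;
   exact: segment_compact.
Qed.

End Matrices.

(** * Quadratic forms and the ellipsoid *)

Section QuadraticForms.
Variables (R : realType) (n : nat).
Implicit Types (X : 'M[R]_n) (x : 'cV[R]_n).

Lemma qformD X Y x : qform (X + Y) x = qform X x + qform Y x.
Proof. by rewrite /qform mulmxDr mulmxDl mxE. Qed.

Lemma qformZ X s x : qform X (s *: x) = s ^+ 2 * qform X x.
Proof.
by rewrite /qform [(_ *: x)^T]linearZ /= -scalemxAr -!scalemxAl !mxE mulrA.
Qed.

Lemma qform_rank1 (a : 'cV[R]_n) x : qform (a *m a^T) x = (a^T *m x) 0 0 ^+ 2.
Proof.
rewrite /qform mulmxA -mulmxA mxE big_ord1 expr2; congr (_ * _).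
have -> : x^T *m a = (a^T *m x)^T by rewrite trmx_mul trmxK.
by rewrite mxE.
Qed.

Lemma cvg_qform (T : Type) (F : set_system T) {FF : Filter F} X
    (g : T -> 'cV[R]_n) x : g @ F --> x -> qform X (g t) @[t --> F] --> qform X x.
Proof.
move=> gx; apply: cvg_mulmx => //; apply: cvg_mx => i j.
by apply: cvg_mulmx; [exact: cvg_trmx | exact: cvg_cst].
Qed.

Lemma sqnormFZ s x : sqnormF (s *: x) = s ^+ 2 * sqnormF x.
Proof. by rewrite /sqnormF mulr_sumr; apply: eq_bigr => i _; rewrite mxE exprMn. Qed.

Lemma sqnormF_ge0 x : 0 <= sqnormF x.
Proof. by apply: sumr_ge0 => i _; exact: sqr_ge0. Qed.

Lemma cvg_sqnormF (T : Type) (F : set_system T) {FF : Filter F}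
    (g : T -> 'cV[R]_n) x : g @ F --> x -> sqnormF (g t) @[t --> F] --> sqnormF x.
Proof.
by move=> gx; apply: cvg_bigsum => i; rewrite expr2; under eq_cvg do rewrite expr2;
  apply: cvgM; exact: cvg_coord.
Qed.

(** Closed as the preimage of a half-line; bounded since [x] is [invmx C] applied to [C *m x], whose
    coordinates have absolute value at most 1. *)
Lemma compact_ellipsoid (C : 'M[R]_n) : C \in unitmx ->
  compact [set x | sqnormF (C *m x) <= 1].
Proof.
move=> Cu; pose c := \sum_i \sum_j `|invmx C i j|.
apply: subclosed_compact (@compact_cV_box R n c) _.
  apply: (@preimage_closed _ _ (fun x : 'cV[R]_n => sqnormF (C *m x))
    [set y : R | y <= 1]); last exact: closed_le.
  move=> x _; apply: (@cvg_sqnormF _ (nbhs x) _ (mulmx C)).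
  apply: cvg_mx => i j.
  by apply: (@cvg_mulmx _ _ (nbhs x) _ _ _ _ (fun=> C) id) => //; exact: cvg_cst.
move=> x /= Cx1 i; rewrite -[x](mulKmx Cu) mxE.
have y1 j : `|(C *m x) j 0| <= 1.
  rewrite -(@ler_pXn2r _ 2) ?nnegrE// expr1n real_normK ?num_real//.
  apply: le_trans Cx1; rewrite /sqnormF (bigD1 j) //= lerDl.
  by apply: sumr_ge0 => k _; exact: sqr_ge0.
apply: le_trans (ler_norm_sum _ _ _) _.
apply: (@le_trans _ _ (\sum_j `|invmx C i j|)).
  by apply: ler_sum => j _; rewrite normrM ler_piMr.
by rewrite /c [leRHS](bigD1 i) //= lerDl; apply: sumr_ge0 => k _; exact: sumr_ge0.
Qed.

End QuadraticForms.

(** The positive limit keeps the base eventually positive, where the power is [expR (p * ln _)]; at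
    0 [powR] follows a separate convention. *)
Lemma cvg_powR (R : realType) (T : Type) (F : set_system T) {FF : Filter F}
    (f : T -> R) (l p : R) : 0 < l -> f @ F --> l ->
  (f t) `^ p @[t --> F] --> l `^ p.
Proof.
move=> l0 fl; rewrite {2}/powR gt_eqF//.
apply: (@cvg_trans _ (expR (p * ln (f t)) @[t --> F])); last first.
  apply: continuous_cvg; first exact: continuous_expR.
  apply: cvgM; first exact: cvg_cst.
  by apply: continuous_cvg => //; exact: continuous_ln.
apply: near_eq_cvg.
have : \forall t \near F, 0 < f t by exact: (cvgr_gt l).
by apply: filterS => t ft0; rewrite /powR gt_eqF.
Qed.

(** * Alternating exact minimization over the ellipsoid *)

Section AlternatingMinimization.
Variables (R : realType) (n K : nat).
Variables (A B : 'I_K -> 'M[R]_n) (C : 'M[R]_n) (P : R).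
Hypotheses (P_gt0 : 0 < P) (K_gt0 : (0 < K)%N).
Hypothesis A_ge0 : forall k x, 0 <= qform (A k) x.
Hypothesis A_gt0 : exists k x, 0 < qform (A k) x.
Hypothesis C_unit : C \in unitmx.
Hypothesis num_gt0 : forall k x, sqnormF (C *m x) <= 1 -> 0 < num B P k x.
Implicit Types (x mu : 'cV[R]_n) (lam : 'rV[R]_K).

Let ball1 : set 'cV[R]_n := [set x | sqnormF (C *m x) <= 1].
Let r k x := num B P k x / den A B P k x.

Lemma denE k x : den A B P k x = num B P k x + qform (A k) x.
Proof. by rewrite /den /num qformD addrA addrAC. Qed.

Lemma den_gt0 k x : 0 < num B P k x -> 0 < den A B P k x.
Proof. by move=> h; rewrite denE ltr_pwDl. Qed.

Lemma ratio_gt0 k x : 0 < num B P k x -> 0 < num B P k x / den A B P k x.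
Proof. by move=> h; rewrite divr_gt0// den_gt0. Qed.

Lemma cvg_num (T : Type) (F : set_system T) {FF : Filter F} k
    (g : T -> 'cV[R]_n) x :
  g @ F --> x -> num B P k (g t) @[t --> F] --> num B P k x.
Proof. by move=> gx; apply: cvgD; [exact: cvg_cst | exact: cvg_qform]. Qed.

Lemma cvg_den (T : Type) (F : set_system T) {FF : Filter F} k
    (g : T -> 'cV[R]_n) x :
  g @ F --> x -> den A B P k (g t) @[t --> F] --> den A B P k x.
Proof. by move=> gx; apply: cvgD; [exact: cvg_cst | exact: cvg_qform]. Qed.

Lemma cvg_ratio (T : Type) (F : set_system T) {FF : Filter F} k
    (g : T -> 'cV[R]_n) x : 0 < num B P k x -> g @ F --> x ->
  num B P k (g t) / den A B P k (g t) @[t --> F] --> num B P k x / den A B P k x.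
Proof.
move=> x0 gx; apply: cvgM; first exact: cvg_num.
by apply: cvgV; [rewrite gt_eqF// den_gt0 | exact: cvg_den].
Qed.

Lemma cvg_objective (T : Type) (F : set_system T) {FF : Filter F}
    (g : T -> 'cV[R]_n) (h : T -> 'rV[R]_K) x lam :
  (forall k, 0 < num B P k x) -> g @ F --> x -> h @ F --> lam ->
  objective A B P (g t, h t) @[t --> F] --> objective A B P (x, lam).
Proof.
move=> x0 gx hl; apply: cvg_bigsum => k; apply: cvgM; first exact: cvg_coord.
exact: cvg_ratio.
Qed.

Lemma cvg_lambda_step (T : Type) (F : set_system T) {FF : Filter F}
    (g : T -> 'cV[R]_n) x : (forall k, 0 < num B P k x) -> g @ F --> x ->
  lambda_step A B P (g t) @[t --> F] --> lambda_step A B P x.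
Proof.
move=> x0 gx; apply: cvg_mx => i j; rewrite mxE; under eq_cvg do rewrite mxE.
apply: cvgM.
  apply: cvg_powR; first by apply: prodr_gt0 => k _; exact: ratio_gt0.
  by apply: cvg_bigprod => k; exact: cvg_ratio.
apply: cvgM; first exact: cvg_den.
by apply: cvgV; [rewrite gt_eqF | exact: cvg_num].
Qed.

Lemma lambda_step_gt0 x i : (forall k, 0 < num B P k x) ->
  0 < lambda_step A B P x 0 i.
Proof.
move=> x0; rewrite mxE mulr_gt0 ?powR_gt0 ?divr_gt0 ?den_gt0//.
by apply: prodr_gt0 => k _; exact: ratio_gt0.
Qed.

(** The factor [den / num] in the step cancels the ratio, so all weighted terms equal the geometric
    mean of the ratios: the equality case of AM-GM. *)
Lemma lambda_stepM x i : (forall k, 0 < num B P k x) ->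
  lambda_step A B P x 0 i * (num B P i x / den A B P i x) =
  (\prod_l (num B P l x / den A B P l x)) `^ K%:R^-1.
Proof.
move=> x0; rewrite mxE -mulrA -[X in _ * (X * _)]invf_div mulVf ?mulr1//.
by rewrite gt_eqF// ratio_gt0.
Qed.

Lemma powR_prod_ratio x : (forall k, 0 < num B P k x) ->
  ((\prod_l (num B P l x / den A B P l x)) `^ K%:R^-1) ^+ K =
  \prod_l (num B P l x / den A B P l x).
Proof.
move=> x0; rewrite -powR_mulrn ?powR_ge0// -powRrM mulVf ?powRr1//.
  by apply: prodr_ge0 => k _; rewrite ltW// ratio_gt0.
by rewrite pnatr_eq0 -lt0n.
Qed.

Lemma prod_lambda_step x : (forall k, 0 < num B P k x) ->
  \prod_i lambda_step A B P x 0 i = 1.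
Proof.
move=> x0; have rp : \prod_l (num B P l x / den A B P l x) != 0.
  by rewrite gt_eqF//; apply: prodr_gt0 => k _; exact: ratio_gt0.
(* Multiplied by the product of the ratios, the claim says that [K] copies of their geometric mean
   multiply to that product. *)
apply: (mulIf rp); rewrite mul1r -big_split /=.
under eq_bigr do rewrite lambda_stepM//.
by rewrite prodr_const card_ord powR_prod_ratio.
Qed.

(* AM-GM: the sum is at least K times the geometric mean of the terms, and all
   the terms are equal for [lambda_step]. *)
Lemma lambda_step_min x lam : (forall k, 0 < num B P k x) ->
  \prod_i lam 0 i = 1 -> (forall i, 0 <= lam 0 i) ->
  objective A B P (x, lambda_step A B P x) <= objective A B P (x, lam).
Proof.
move=> x0 lam1 lam0; rewrite /objective /=.
under eq_bigr do rewrite lambda_stepM//.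
have lr0 k : 0 <= lam 0 k * (num B P k x / den A B P k x).
  by rewrite mulr_ge0// ltW// ratio_gt0.
(* Both sides are nonnegative, so their [K]-th powers are compared, which removes the root. *)
rewrite sumr_const card_ord -(@ler_pXn2r _ K) ?nnegrE ?sumr_ge0//; last first.
  by rewrite mulrn_wge0// powR_ge0.
have [+ _] := @leif_AGM_scaled R 'I_K predT
  (fun k => lam 0 k * (num B P k x / den A B P k x))
  (fun k _ => mulrn_wge0 _ (lr0 k)).
rewrite cardT size_enum_ord => amgm; apply: le_trans amgm.
under [leRHS]eq_bigr do rewrite -mulr_natr.
rewrite exprMn_n powR_prod_ratio// [leRHS]big_split /= [X in _ <= X * _]big_split /=.
by rewrite lam1 mul1r prodr_const cardT size_enum_ord -mulr_natr natrX.
Qed.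

Lemma argmin_exists lam : exists x,
  is_argmin ball1 (fun x => objective A B P (x, lam)) x.
Proof.
have ne : ball1 !=set0.
  by exists 0; rewrite /ball1 /= mulmx0 /sqnormF big1// => i _; rewrite mxE expr0n.
have [|x] := @compact_EVT_min _ _ (fun x => objective A B P (x, lam)) _ ne
  (compact_ellipsoid C_unit).
  apply: continuous_in_subspaceT => x; rewrite inE => x1.
  apply: (@cvg_objective _ (nbhs x) _ id (fun=> lam)).
  - by move=> k; exact: num_gt0.
  - exact: cvg_id.
  - exact: cvg_cst.
rewrite inE => x1 xmin; exists x; split=> // y y1; apply: xmin.
by rewrite inE.
Qed.

Lemma run_exists mu0 : exists (mu : nat -> 'cV[R]_n) (lam : nat -> 'rV[R]_K),
  mu 0%N = mu0 /\ algorithm_run A B C P mu lam.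
Proof.
have [f fP] := choice argmin_exists.
pose mu t := iter t (f \o lambda_step A B P) mu0.
(* The predecessor makes [lam t.+1] the update computed from [mu t]. *)
by exists mu, (fun t => lambda_step A B P (mu t.-1)); split=> // t; split.
Qed.

(** After cross-multiplication the products of two quadratic forms cancel; the constant [P^-1],
    which does not scale, leaves a negative multiple of [qform (A k) x]. *)
Lemma ratio_scale s k x : 1 < s -> sqnormF (C *m (s *: x)) <= 1 ->
  sqnormF (C *m x) <= 1 ->
  num B P k (s *: x) / den A B P k (s *: x) <= num B P k x / den A B P k x
    ?= iff (qform (A k) x == 0).
Proof.
move=> s1 /(@num_gt0 k) sx0 /(@num_gt0 k) x0.
have sd0 := den_gt0 sx0; have d0 := den_gt0 x0.
have E : num B P k (s *: x) * den A B P k x -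
   num B P k x * den A B P k (s *: x) = - ((s ^+ 2 - 1) * P^-1) * qform (A k) x.
  rewrite !denE /num !qformZ; ring.
have c0 : 0 < (s ^+ 2 - 1) * P^-1.
  by rewrite mulr_gt0 ?invr_gt0// subr_gt0 expr_gt1 // ltW// (lt_trans _ s1).
split.
  by rewrite ler_pdivrMr// mulrAC ler_pdivlMr// -subr_le0 E mulNr oppr_le0
     mulr_ge0// ltW.
rewrite eqr_div ?lt0r_neq0// -subr_eq0 E mulf_eq0 oppr_eq0.
by rewrite (gt_eqF c0).
Qed.

(* Off the sphere, either every numerator equals its denominator and the
   objective is maximal, or a dilation decreases it. *)
Lemma argmin_sphere lam x : (forall k, 0 < lam 0 k) ->
  is_argmin ball1 (fun x => objective A B P (x, lam)) x -> sqnormF (C *m x) = 1.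
Proof.
move=> lam0 [x1 xmin]; apply/eqP; rewrite eq_le x1 /= leNgt; apply/negP => xlt1.
have lt_obj y : ball1 y ->
    (forall k, r k y <= r k x) -> (exists k, r k y < r k x) -> False.
  move=> y1 le_yx [k lt_yx]; have := xmin _ y1; rewrite leNgt => /negP; apply.
  rewrite /objective /= (bigD1 k) //= [ltRHS](bigD1 k) //=.
  rewrite ltr_leD// ?ltr_pM2l//; apply: ler_sum => i _.
  by rewrite ler_pM2l// le_yx.
have [Ax|/existsNP[k /eqP Akx]] := pselect (forall k, qform (A k) x = 0).
  have [k [y Aky]] := A_gt0.
  have N0 := sqnormF_ge0 (C *m y); set N := sqnormF _ in N0.
  (* Scaling [y] by [(1 + N)^-1] brings it into the ellipsoid, since N <= (1 + N)^2. *)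
  have s0 : 0 < (1 + N)^-1 by rewrite invr_gt0 ltr_pwDl.
  have y1 : ball1 ((1 + N)^-1 *: y).
    rewrite /ball1 /= -scalemxAr sqnormFZ -/N exprVn mulrC ler_pdivrMr ?mul1r.
      nra.
    by rewrite exprn_gt0 // ltr_pwDl.
  have rx i : r i x = 1.
    by rewrite /r denE Ax addr0 divff// gt_eqF// num_gt0.
  apply: (lt_obj _ y1) => [i|]; last exists k; rewrite rx /r denE.
    rewrite ler_pdivrMr ?mul1r ?lerDl// -denE; exact/den_gt0/num_gt0.
  rewrite ltr_pdivrMr ?mul1r ?ltrDl -?denE; last exact/den_gt0/num_gt0.
  by rewrite qformZ mulr_gt0// exprn_gt0.
have N0 := sqnormF_ge0 (C *m x).
(* With N the squared norm of [C *m x], N < 1 gives [1 < s], and 4N <= (1 + N)^2 keeps [s *: x] in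
   the ellipsoid. *)
pose s := 2 / (1 + sqnormF (C *m x)).
have N1 : 0 < 1 + sqnormF (C *m x) by rewrite ltr_pwDl.
have s1 : 1 < s by rewrite /s ltr_pdivlMr// mul1r; lra.
have sx1 : ball1 (s *: x).
  rewrite /ball1 /= -scalemxAr sqnormFZ /s expr_div_n mulrAC ler_pdivrMr ?mul1r.
    nra.
  by rewrite exprn_gt0.
apply: (lt_obj _ sx1) => [i|]; last exists k.
  exact: (ratio_scale i s1 sx1 x1).
by rewrite (lt_leif (ratio_scale k s1 sx1 x1)).
Qed.

(* Only the multiplier block contributes to first order: moving [mu] with the
   limiting multipliers, or the multipliers with the limiting [mu], cannot
   decrease the objective, and the mixed term is o(|y - w|). *)
Lemma block_optimum_local w : feasible C w ->
  (forall mu, feasible C (mu, w.2) ->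
    objective A B P w <= objective A B P (mu, w.2)) ->
  (forall lam, feasible C (w.1, lam) ->
    objective A B P w <= objective A B P (w.1, lam)) ->
  local_optimum A B C P w.
Proof.
case: w => x l /= [l1 l0 x1] xmin lmin; split=> // e e0 /=.
have x0 k : 0 < num B P k x by apply: num_gt0; rewrite x1.
have near_r : \forall y \near nbhs ((x, l) : 'cV[R]_n * 'rV[R]_K),
    \sum_k `|r k y.1 - r k x| < e.
  have : \sum_k `|r k y.1 - r k x| @[y --> nbhs ((x, l) : 'cV[R]_n * 'rV[R]_K)]
      --> \sum_k `|r k x - r k x|.
    apply: cvg_bigsum => k; apply: cvg_norm; apply: cvgB; last exact: cvg_cst.
    by apply: cvg_ratio => //; exact: cvg_fst.
  move=> h; apply: (cvgr_lt _ h).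
  by rewrite big1// => k _; rewrite subrr normr0.
apply: filterS near_r => -[y g] /= yr [/= g1 g0 y1].
(* The constraints on the two blocks are independent, so feasible points may exchange blocks. *)
have yx : feasible C (y, l) by split.
have gl : feasible C (x, g) by split.
have := xmin _ yx; have := lmin _ gl; rewrite /objective /= => h1 h2.
(* In the mixed term each [g 0 k - l 0 k] is bounded by [|g - l|], and the variations of the ratios
   sum to less than [e] on the chosen neighbourhood. *)
have h3 : - (e * `|((y, g) : 'cV[R]_n * 'rV[R]_K) - (x, l)|) <=
    \sum_k (g 0 k - l 0 k) * (r k y - r k x).
  rewrite lerNl -sumrN.
  apply: (@le_trans _ _ (\sum_k `|r k y - r k x| * `|g - l|)).
    apply: ler_sum => k _; rewrite -mulNr mulrC.
    apply: le_trans (ler_norm _) _; rewrite normrM ler_wpM2l// normrN.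
    by have := ler_mx_norm (g - l) 0 k; rewrite !mxE.
  rewrite -mulr_suml ler_pM ?sumr_ge0//; first exact: ltW.
  by rewrite [leRHS]prod_normE /= le_max lexx orbT.
(* Linearity in the multipliers splits the objective at [(y, g)] into its values at [(y, l)] and
   [(x, g)], minus the value at [(x, l)], plus the mixed term. *)
have -> : \sum_k g 0 k * (num B P k y / den A B P k y) =
  \sum_k l 0 k * r k y + \sum_k g 0 k * r k x - \sum_k l 0 k * r k x +
  \sum_k (g 0 k - l 0 k) * (r k y - r k x).
  rewrite -big_split -sumrB -big_split /=.
  by apply: eq_bigr => k _; rewrite /r; ring.
move: h1 h2 h3; rewrite /r; lra.
Qed.

(** * Monotonicity, cluster points and convergence of a run *)

Section Run.
Variables (mu : nat -> 'cV[R]_n) (lam : nat -> 'rV[R]_K).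
Hypothesis run : algorithm_run A B C P mu lam.
Hypothesis mu0_gt0 : forall k, 0 < num B P k (mu 0%N).

(** The pair after a complete sweep: [mu t.+1] is a minimizer for [lam t.+1]. The shift leaves out
    [mu 0], which may lie outside the ellipsoid. *)
Let z t : 'cV[R]_n * 'rV[R]_K := (mu t.+1, lam t.+1).

Lemma run_num_gt0 t k : 0 < num B P k (mu t).
Proof. by case: t => [//|t]; apply: num_gt0; have [_ []] := run t. Qed.

(** The argmin only asks for the ellipsoid; positivity of the multipliers forces the minimizer onto
    the sphere. *)
Lemma run_feasible t : feasible C (z t).
Proof.
have [lamE mumin] := run t.
have lam0 i : 0 < lam t.+1 0 i by rewrite lamE lambda_step_gt0//; exact: run_num_gt0.
split=> /=; last exact: argmin_sphere mumin.
  by rewrite lamE prod_lambda_step//; exact: run_num_gt0.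
by move=> i; exact: ltW.
Qed.

Lemma run_half_step t :
  objective A B P (mu t.+1, lambda_step A B P (mu t.+1)) <= objective A B P (z t).
Proof.
have [lam1 lam0 _] := run_feasible t.
by apply: lambda_step_min => //; exact: run_num_gt0.
Qed.

(** [mu t.+1] competes in the minimization that selects [mu t.+2], whose multipliers are
    [lambda_step (mu t.+1)]. *)
Lemma run_next_half_step t : objective A B P (z t.+1) <=
  objective A B P (mu t.+1, lambda_step A B P (mu t.+1)).
Proof.
have [<- [_ mumin]] := run t.+1; apply: mumin => /=.
by have [_ _ /= ->] := run_feasible t.
Qed.

Lemma run_nonincreasing : nonincreasing_seq (objective A B P \o z).
Proof.
apply/nonincreasing_seqP => t /=.
exact: le_trans (run_next_half_step t) (run_half_step t).
Qed.

Lemma run_cvg :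
  objective A B P (z t) @[t --> \oo] --> inf (range (objective A B P \o z)).
Proof.
apply: nonincreasing_cvgn; first exact: run_nonincreasing.
exists 0 => _ [t _ <-]; apply: sumr_ge0 => k _.
have [_ lam0 _] := run_feasible t.
by rewrite mulr_ge0// ltW// ratio_gt0// run_num_gt0.
Qed.

(** Squeezed between consecutive values of the run. At a cluster point this shows that re-optimizing
    the multipliers brings no gain. *)
Lemma run_half_step_cvg :
  objective A B P ((z t).1, lambda_step A B P (z t).1) @[t --> \oo] -->
  inf (range (objective A B P \o z)).
Proof.
apply: (@squeeze_cvgr _ _ _ _ (fun t => objective A B P (z t.+1))
  (objective A B P \o z)).
- by apply: nearW => t; rewrite run_half_step run_next_half_step.
- by rewrite (@cvg_shiftS _ (fun t => objective A B P (z t))); exact: run_cvg.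
- exact: run_cvg.
Qed.

(** The multipliers lie in the continuous image of the ellipsoid under [lambda_step]. *)
Lemma run_compact : exists2 D : set ('cV[R]_n * 'rV[R]_K), compact D &
  \forall t \near \oo, D (z t).
Proof.
exists (ball1 `*` (lambda_step A B P @` ball1)).
  apply: compact_setX; first exact: compact_ellipsoid.
  apply: continuous_compact; last exact: compact_ellipsoid.
  apply: continuous_in_subspaceT => x; rewrite inE => x1.
  apply: (@cvg_lambda_step _ (nbhs x) _ id) => [k|]; last exact: cvg_id.
  exact: num_gt0.
(* [lam t.+1] comes from [mu t], which is known to lie in the ellipsoid only for positive [t]. *)
near=> t; have t0 : (0 < t)%N by near: t; exists 1%N.
rewrite -(prednK t0); split=> /=.
  by rewrite /ball1 /=; have [_ []] := run t.-1.+1.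
exists (mu t.-1.+1); last by have [] := run t.-1.+1.
by have [_ []] := run t.-1.
Unshelve. all: by end_near. Qed.

(** Feasibility and optimality in [mu] are closed conditions that hold along the run; optimality in
    the multipliers holds because the half-step values have the same limit. *)
Lemma run_cluster w : cluster (z @ \oo) w -> local_optimum A B C P w /\
  objective A B P w = inf (range (objective A B P \o z)).
Proof.
case: w => x l xl.
have c1 : {for (x, l),
    continuous (fst : 'cV[R]_n * 'rV[R]_K -> _)} by exact: cvg_fst.
have c2 : {for (x, l),
    continuous (snd : 'cV[R]_n * 'rV[R]_K -> _)} by exact: cvg_snd.
have cl (h : 'cV[R]_n * 'rV[R]_K -> R) (D : set R) :
    {for (x, l), continuous h} ->
    closed D -> (forall t, D (h (z t))) -> D (h (x, l)).
  by move=> hc clD Dz; apply: (cluster_closed xl hc clD);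
     exists 0%N => // t _; exact: Dz.
have prod1 : \prod_i l 0 i = 1.
  refine (cl (fun y => \prod_i y.2 0 i) [set a : R | a = 1] _ _ _).
  - by apply: cvg_bigprod => i; exact: cvg_coord.
  - exact: closed_eq.
  - by move=> t; have [] := run_feasible t.
have l0 i : 0 <= l 0 i.
  refine (cl (fun y => y.2 0 i) [set a : R | 0 <= a] _ _ _).
  - exact: cvg_coord.
  - exact: closed_ge.
  - by move=> t; have [_ + _] := run_feasible t; exact.
have x1 : sqnormF (C *m x) = 1.
  refine (cl (fun y => sqnormF (C *m y.1)) [set a : R | a = 1] _ _ _).
  - apply: (@cvg_sqnormF _ _ _ _ _ (fun y : 'cV[R]_n * 'rV[R]_K => C *m y.1)).
    apply: cvg_mx => i j.
    by apply: (@cvg_mulmx _ _ _ _ _ _ _ (fun=> C) fst) => //; exact: cvg_cst.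
  - exact: closed_eq.
  - by move=> t; have [] := run_feasible t.
have x0 k : 0 < num B P k x by apply: num_gt0; rewrite x1.
have cobj : {for (x, l), continuous (objective A B P)}.
  rewrite (_ : objective A B P = fun y => objective A B P (y.1, y.2)).
    exact: cvg_objective.
  by apply/funext => -[].
have objE : objective A B P (x, l) = inf (range (objective A B P \o z)).
  by apply: (cluster_lim _ xl cobj); [exact: norm_hausdorff | exact: run_cvg].
have halfE : objective A B P (x, lambda_step A B P x) =
    inf (range (objective A B P \o z)).
  apply: (cluster_lim
    (h := fun y => objective A B P (y.1, lambda_step A B P y.1)) _ xl).
  - exact: norm_hausdorff.
  - by apply: cvg_objective => //; exact: cvg_lambda_step.
  - exact: run_half_step_cvg.
split=> //; apply: block_optimum_local => // [y [_ _ /= y1]|g [/= g1 g0 _]].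
  have y0 k : 0 < num B P k y by apply: num_gt0; rewrite y1.
  (* For a fixed competitor [y] the inequality holds at every iterate; as the sign of a continuous
     function of the iterate it passes to the cluster point. *)
  rewrite -subr_ge0.
  refine (cl (fun v => objective A B P (y, v.2) - objective A B P v)
    [set a : R | 0 <= a] _ _ _).
  - by apply: cvgB => //; apply: cvg_objective => //; exact: cvg_cst.
  - exact: closed_ge.
  - move=> t /=; rewrite subr_ge0; have [_ [_]] := run t; apply.
    by rewrite /= y1.
by rewrite objE -halfE; exact: lambda_step_min.
Qed.

Lemma run_converges : converges_to_local_optimum A B C P z.
Proof.
split; first exact: run_nonincreasing.
exists (inf (range (objective A B P \o z))); split.
- exact: run_cvg.
- move=> e e0; have [D cD nD] := run_compact.
  apply: filterS (compact_near_cluster e0 cD nD) => t [w zw zwe].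
  by exists w => //; exact: run_cluster.
- exact: run_cluster.
Qed.

End Run.

End AlternatingMinimization.

(** * Structure of the constant matrices *)

Section Coefficients.
Variables (R : realType) (n p K : nat).
Variable Theta : 'I_K -> 'M[R[i]]_(n * p).
Variables (sigma : 'I_n -> 'I_K -> R) (rho : 'I_n -> 'I_n -> 'I_K -> R).
Variables (alpha : 'I_n -> R) (m : 'I_n -> 'I_K -> R).
Hypothesis GamI_gt0 : forall j, 0 < Gam Theta sigma rho alpha m j j 1%:M.

(** Each entry factors as [u i * u j]: the square root of the product splits because both factors
    [g i] and [g j] are nonnegative, and [u] is real because [Phi] is. *)
Lemma Amat_rank1 k (A : 'M[R]_n) :
  (forall j, 0 <= sigma j k <= 1) ->
  (forall j, Phi Theta alpha m j k \is Num.real) ->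
  map_mx (real_complex R) A = Amat Theta sigma rho alpha m k ->
  exists a : 'cV[R]_n, A = a *m a^T.
Proof.
move=> sigma01 Phi_real AE.
pose g j := (c0 sigma j k)%:C / Gam Theta sigma rho alpha m j j 1%:M.
have g0 j : 0 <= g j.
  rewrite divr_ge0 ?(ltW (GamI_gt0 j))// lecR /c0 subr_ge0 expr_le1//.
    by have /andP[] := sigma01 j.
  by have /andP[] := sigma01 j.
pose u j := sqrtC (g j) * (Phi Theta alpha m j k / (1 + (m j k)%:C)).
have ur j : u j \is Num.real.
  by rewrite rpredM ?sqrtC_real// rpred_div// rpredD// complex_real.
exists (\col_j complex.Re (u j)); apply/matrixP => i j.
rewrite !mxE big_ord1 !mxE; apply: (@complexI R).
rewrite rmorphM /= !RRe_real//.
have /matrixP/(_ i j) := AE; rewrite !mxE /= => ->.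
have -> : (c0 sigma i k * c0 sigma j k)%:C /
  (Gam Theta sigma rho alpha m i i 1%:M * Gam Theta sigma rho alpha m j j 1%:M)
  = g i * g j by rewrite /g rmorphM invfM mulrACA.
by rewrite sqrtCM ?nnegrE// invfM /u [RHS]mulrACA [X in _ = _ * X]mulrACA.
Qed.

Lemma Cmat_unit (C : 'M[R]_n) :
  (forall j, 0 < Gam Theta sigma rho alpha m j j (EEmx R p j)) ->
  map_mx (real_complex R) C = Cmat Theta sigma rho alpha m -> C \in unitmx.
Proof.
move=> GamE_gt0 CE; rewrite -(map_unitmx (real_complex R)) CE unitmxE.
rewrite det_diag unitfE.
by apply/prodf_neq0 => j _; rewrite mxE sqrtC_eq0 gt_eqF// divr_gt0.
Qed.

End Coefficients.

(** * Convergence for the deterministic-equivalent coefficients *)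

Theorem theorem3 (R : realType) (n p K : nat)
  (n_gt0 : (0 < n)%N) (p_gt0 : (0 < p)%N) (K_gt0 : (0 < K)%N)
  (beta_ge1 : (K <= n * p)%N)
  (Theta : 'I_K -> 'M[R[i]]_(n * p))
  (Theta_psd : forall k, psdmx (Theta k))
  (sigma : 'I_n -> 'I_K -> R)
  (sigma01 : forall j k, 0 <= sigma j k <= 1)
  (rho : 'I_n -> 'I_n -> 'I_K -> R)
  (rho01 : forall j j' k, 0 <= rho j j' k <= 1)
  (rho_diag : forall j k, rho j j k = 1)
  (alpha : 'I_n -> R) (alpha_gt0 : forall j, 0 < alpha j)
  (P : R) (P_gt0 : 0 < P)
  (m : 'I_n -> 'I_K -> R) (m_sol : is_m_solution Theta alpha m)
  (Phi_real : forall j k, Phi Theta alpha m j k \is Num.real)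
  (G_unit : forall j j', Gmx Theta sigma rho alpha m j j' \in unitmx)
  (GamI_gt0 : forall j, 0 < Gam Theta sigma rho alpha m j j 1%:M)
  (GamE_gt0 : forall j, 0 < Gam Theta sigma rho alpha m j j (EEmx R p j))
  (A B : 'I_K -> 'M[R]_n) (C : 'M[R]_n)
  (A_def : forall k,
     map_mx (real_complex R) (A k) = Amat Theta sigma rho alpha m k)
  (B_def : forall k,
     map_mx (real_complex R) (B k) = Bmat Theta sigma rho alpha m k)
  (C_def : map_mx (real_complex R) C = Cmat Theta sigma rho alpha m)
  (A_neq0 : exists k, A k != 0)
  (num_gt0 : forall k (x : 'cV[R]_n), sqnormF (C *m x) <= 1 -> 0 < num B P k x)
  (mu0 : 'cV[R]_n) (num0_gt0 : forall k, 0 < num B P k mu0) :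
  (exists (mu : nat -> 'cV[R]_n) (lam : nat -> 'rV[R]_K),
     mu 0%N = mu0 /\ algorithm_run A B C P mu lam) /\
  (forall (mu : nat -> 'cV[R]_n) (lam : nat -> 'rV[R]_K),
     mu 0%N = mu0 -> algorithm_run A B C P mu lam ->
     converges_to_local_optimum A B C P (fun t => (mu t.+1, lam t.+1))).
Proof.
have A_rank1 k : exists a : 'cV[R]_n, A k = a *m a^T.
  exact: (Amat_rank1 GamI_gt0 (sigma01^~ k) (Phi_real^~ k) (A_def k)).
have A_ge0 k x : 0 <= qform (A k) x.
  by have [a ->] := A_rank1 k; rewrite qform_rank1 sqr_ge0.
have A_gt0 : exists k x, 0 < qform (A k) x.
  have [k Ak0] := A_neq0; have [a Ak] := A_rank1 k.
  (* The factor [a] is its own witness: the form there is the square of [a^T *m a], a sum of squares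
     that vanishes only if [a], and hence [A k], is zero. *)
  exists k, a; rewrite lt0r A_ge0 andbT Ak qform_rank1 sqrf_eq0.
  apply: contra_neq Ak0 => aa0; rewrite Ak (_ : a = 0) ?mul0mx//.
  apply/colP => i; rewrite mxE; apply/eqP; rewrite -sqrf_eq0.
  move: aa0; rewrite mxE => /eqP; rewrite psumr_eq0 => [|j _].
    by move=> /allP/(_ i (mem_index_enum _)); rewrite mxE -expr2.
  by rewrite mxE -expr2 sqr_ge0.
have C_unit := Cmat_unit GamI_gt0 GamE_gt0 C_def.
split; first exact: run_exists.
by move=> mu lam mu0E run; apply: run_converges => // k; rewrite mu0E.
Qed.
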